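(* Let $r,d\ge 1$ and let $S_{r,d}$ be the free solvable group of rank $r$ and derived length $d$. Let $H$ be a finitely generated verbally closed subgroup of $S_{r,d}$ with $r_{ab}(H)=1$. Then $H$ is a retract of $S_{r,d}$.
   Context: For a group $G$, the derived series is $G^{(0)}=G$, $G^{(i+1)}=[G^{(i)},G^{(i)}]$, and $G'=G^{(1)}$. $S_{r,d}=F_r/F_r^{(d)}$, where $F_r$ is the free group of rank $r$; i.e. the free group of rank $r$ in the variety of all solvable groups of derived length at most $d$. For a finitely generated subgroup $H\le G$, $r_{ab}(H)$ denotes the minimal number of generators of the abelian group $HG'/G'$. A subgroup $H\le G$ is verbally closed in $G$ if for every group word $w(x_1,\dots,x_n)$ (without constants) and every $h\in H$, if the equation $w(x_1,\dots,x_n)=h$ has a solution in $G$, then it has a solution in $H$. A subgroup $H\le G$ is a retract of $G$ if there is an endomorphism (retraction) $\rho:G\to H$ of $G$ with image in $H$ that is the identity on $H$. *)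

(* Defs.v *)
From Stdlib Require Import List Arith.
Import ListNotations.

Record grp := Grp {
  gcar :> Type;
  gmul : gcar -> gcar -> gcar;
  ginv : gcar -> gcar;
  gone : gcar;
  gmulA : forall a b c, gmul a (gmul b c) = gmul (gmul a b) c;
  gmul1 : forall a, gmul gone a = a;
  gmulV : forall a, gmul (ginv a) a = gone
}.
Arguments gmul {g}. Arguments ginv {g}. Arguments gone {g}.

Definition gcomm {G : grp} (a b : G) : G :=
  gmul (gmul (ginv a) (ginv b)) (gmul a b).

Inductive gen {G : grp} (S : G -> Prop) : G -> Prop :=
| gen_base : forall a, S a -> gen S a
| gen_one : gen S gone
| gen_mul : forall a b, gen S a -> gen S b -> gen S (gmul a b)
| gen_inv : forall a, gen S a -> gen S (ginv a).

Definition is_subgroup {G : grp} (H : G -> Prop) : Prop :=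
  H gone /\ (forall a b, H a -> H b -> H (gmul a b)) /\ (forall a, H a -> H (ginv a)).

Fixpoint derived {G : grp} (i : nat) : G -> Prop :=
  match i with
  | 0 => fun _ => True
  | S i => gen (fun z => exists a b, derived i a /\ derived i b /\ z = gcomm a b)
  end.

Definition dl_le {G : grp} (d : nat) : Prop := forall g : G, derived d g -> g = gone.

Definition is_hom {G K : grp} (f : G -> K) : Prop :=
  forall a b, f (gmul a b) = gmul (f a) (f b).

(* (G, x_0..x_{r-1}) is the free group of rank r in the variety of solvable
   groups of derived length <= d, i.e. G is isomorphic to S_{r,d} = F_r/F_r^(d)
   with x_i the images of the free generators: G lies in the variety, is
   generated by the x_i, and any map of the x_i into a group of the variety
   extends to a homomorphism. *)
Definition free_solvable (G : grp) (r d : nat) (x : nat -> G) : Prop :=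
  dl_le (G := G) d /\
  (forall g : G, gen (fun z => exists i, i < r /\ z = x i) g) /\
  (forall (K : grp) (y : nat -> K), dl_le (G := K) d ->
     exists f : G -> K, is_hom f /\ forall i, i < r -> f (x i) = y i).

Definition fin_gen {G : grp} (H : G -> Prop) : Prop :=
  exists l : list G, forall g, H g <-> gen (fun z => In z l) g.

Inductive word : Type :=
| wvar : nat -> word
| wone : word
| wmul : word -> word -> word
| winv : word -> word.

Fixpoint weval {G : grp} (a : nat -> G) (w : word) : G :=
  match w with
  | wvar i => a i
  | wone => gone
  | wmul u v => gmul (weval a u) (weval a v)
  | winv u => ginv (weval a u)
  end.

Definition verbally_closed {G : grp} (H : G -> Prop) : Prop :=
  forall (w : word) (h : G), H h ->
    (exists a : nat -> G, weval a w = h) ->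
    exists b : nat -> G, (forall i, H (b i)) /\ weval b w = h.

(* l (a list of elements of H) generates HG'/G' : every h in H is congruent
   modulo G' = G^(1) to an element of the subgroup generated by l. *)
Definition rab_gen {G : grp} (H : G -> Prop) (l : list G) : Prop :=
  (forall g, In g l -> H g) /\
  forall h, H h -> exists w, gen (fun z => In z l) w /\ derived 1 (gmul h (ginv w)).

Definition rab_eq {G : grp} (H : G -> Prop) (n : nat) : Prop :=
  (exists l, length l = n /\ rab_gen H l) /\
  (forall l, rab_gen H l -> n <= length l).

Definition is_retract {G : grp} (H : G -> Prop) : Prop :=
  exists rho : G -> G, is_hom rho /\ (forall g, H (rho g)) /\ (forall h, H h -> rho h = h).

(* Main.v *)
(* Write [H'] for the commutator subgroup of [H].  Verbal closure applied to
   products of commutators gives [H \cap G' = H'].  If [h] generates [H] modulo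
   [G'] and [h = g^k] modulo [G'] with [k] the gcd of its exponent sums, verbal
   closure applied to "[k]-th power times commutators" gives [k = 1], so there is
   [e : G -> Z] with [e h = 1], and [H = H' <h>].

   It remains to see that [H' = 1], for then [g |-> h^(e g)] is a retraction.
   If [H'] lies in [G^(i)], [i >= 1], the image [T] of [H'] in
   [G^(i)/G^(i+1)] satisfies [T = (t - 1) T], where [t] is conjugation by [h].
   By the Magnus embedding [G^(i)/G^(i+1)] sits in a free [Z[G/G^(i)]]-module,
   where [t] has infinite order, and there no nonzero element is divisible by all
   powers of [t - 1].  Hence [T = 0] and [H'] lies in [G^(i+1)]. *)

Require Import Defs.
From Stdlib Require Import List Arith ZArith Lia ssreflect.
From Stdlib Require Import Classical ClassicalEpsilon.
From Stdlib Require Import FunctionalExtensionality PropExtensionality.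
Import ListNotations.

Declare Scope grp_scope.
Delimit Scope grp_scope with grp.
Notation "a ** b" := (gmul a b) (at level 40, left associativity) : grp_scope.
Notation "a ^-" := (ginv a) (at level 3, left associativity, format "a ^-") : grp_scope.
Local Open Scope grp_scope.

(** * Group calculus and integer powers *)

Lemma gmulI {G : grp} (a b c : G) : a ** b = a ** c -> b = c.
Proof.
  move=> E; by rewrite -(gmul1 _ b) -(gmul1 _ c) -(gmulV _ a) -!gmulA E.
Qed.

Lemma gmulr1 {G : grp} (a : G) : a ** gone = a.
Proof. by apply: (gmulI a^-); rewrite gmulA gmulV gmul1. Qed.

Lemma gmulrV {G : grp} (a : G) : a ** a^- = gone.
Proof. by apply: (gmulI a^-); rewrite gmulA gmulV gmul1 gmulr1. Qed.

Lemma gmulK {G : grp} (a b : G) : a ** b ** b^- = a.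
Proof. by rewrite -gmulA gmulrV gmulr1. Qed.

Lemma gmulVK {G : grp} (a b : G) : a ** b^- ** b = a.
Proof. by rewrite -gmulA gmulV gmulr1. Qed.

Lemma ginv_unique {G : grp} (a b : G) : a ** b = gone -> a^- = b.
Proof. by move=> E; apply: (gmulI a); rewrite E gmulrV. Qed.

Lemma ginvK {G : grp} (a : G) : a^-^- = a.
Proof. by apply: ginv_unique; rewrite gmulV. Qed.

Lemma ginv1 {G : grp} : (@gone G)^- = gone.
Proof. by apply: ginv_unique; rewrite gmul1. Qed.

Lemma ginvM {G : grp} (a b : G) : (a ** b)^- = b^- ** a^-.
Proof. by apply: ginv_unique; rewrite gmulA gmulK gmulrV. Qed.

Ltac group_simp :=
  rewrite ?ginvM ?ginvK ?ginv1 ?gmulA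
    ?(gmul1, gmulr1, gmulV, gmulrV, gmulK, gmulVK, ginv1) //.

Lemma gmulV1_eq {G : grp} (a b : G) : a ** b^- = gone -> a = b.
Proof. by move=> E; rewrite -(gmulVK a b) E gmul1. Qed.

Lemma gcomm1 {G : grp} (a b : G) : gcomm a b = gone <-> a ** b = b ** a.
Proof.
  rewrite /gcomm -ginvM; split=> [E|->]; last by rewrite gmulV.
  by apply: (gmulI (b ** a)^-); rewrite E gmulV.
Qed.

Lemma hom1 {G K : grp} (f : G -> K) : is_hom f -> f gone = gone.
Proof. by move=> fM; apply: (gmulI (f gone)); rewrite -fM gmul1 gmulr1. Qed.

Lemma homV {G K : grp} (f : G -> K) a : is_hom f -> f a^- = (f a)^-.
Proof.
  by move=> fM; symmetry; apply: ginv_unique; rewrite -fM gmulrV hom1.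
Qed.

Definition zpow {G : grp} (a : G) (z : Z) : G :=
  match z with
  | Z0 => gone
  | Zpos p => Pos.iter (gmul a) gone p
  | Zneg p => Pos.iter (gmul a^-) gone p
  end.

Lemma zpow_succ {G : grp} (a : G) z : zpow a (Z.succ z) = a ** zpow a z.
Proof.
  case: z => [|p|p] //=; first by rewrite Pos.add_1_r Pos.iter_succ.
  case: (Pos.eq_dec p 1) => [->|np] /=; first by group_simp.
  rewrite -(Pos.succ_pred p np) Pos.iter_succ.
  have -> : Z.pos_sub 1 (Pos.succ (Pos.pred p)) = Zneg (Pos.pred p).
    by change (1 + Zneg (Pos.succ (Pos.pred p)) = Zneg (Pos.pred p))%Z; lia.
  by group_simp.
Qed.

(** Left multiplication by [a] is invertible, so the successor rule also fixes the values at
    negative integers. The laws below for sums, products and homomorphic images of powers then need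
    only this rule. *)
Lemma zpow_unique {G : grp} (a : G) (F : Z -> G) :
  F 0%Z = gone -> (forall z, F (Z.succ z) = a ** F z) -> forall z, F z = zpow a z.
Proof.
  move=> F0 FS; elim/Z.peano_ind => [//|z IH|z IH].
    by rewrite FS IH zpow_succ.
  by apply: (gmulI a); rewrite -FS -zpow_succ Z.succ_pred.
Qed.

Lemma zpow1 {G : grp} (a : G) : zpow a 1 = a.
Proof. by rewrite (zpow_succ a 0) /= gmulr1. Qed.

Lemma zpowD {G : grp} (a : G) m n : zpow a (m + n) = zpow a m ** zpow a n.
Proof.
  suff E : zpow a (m + n) ** (zpow a n)^- = zpow a m by rewrite -E gmulVK.
  apply: (zpow_unique a (fun m => zpow a (m + n) ** (zpow a n)^-)) => [|z].
    by rewrite Z.add_0_l gmulrV.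
  by rewrite Z.add_succ_l zpow_succ gmulA.
Qed.

Lemma zpowN {G : grp} (a : G) m : zpow a (- m) = (zpow a m)^-.
Proof. by symmetry; apply: ginv_unique; rewrite -zpowD Z.add_opp_diag_r. Qed.

Lemma zpowC {G : grp} (a : G) m n :
  zpow a m ** zpow a n = zpow a n ** zpow a m.
Proof. by rewrite -!zpowD Z.add_comm. Qed.

Lemma zpowM {G : grp} (a : G) m n : zpow a (m * n) = zpow (zpow a m) n.
Proof.
  apply: (zpow_unique _ (fun n => zpow a (m * n))) => [|z].
    by rewrite Z.mul_0_r.
  by rewrite Z.mul_succ_r Z.add_comm zpowD.
Qed.

Lemma hom_zpow {G K : grp} (f : G -> K) a z :
  is_hom f -> f (zpow a z) = zpow (f a) z.
Proof.
  move=> fM; apply: (zpow_unique _ (fun z => f (zpow a z))) => [|n].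
    exact: hom1.
  by rewrite zpow_succ fM.
Qed.

Lemma zpow_commM {G : grp} (a b : G) z : (forall u v : G, u ** v = v ** u) ->
  zpow (a ** b) z = zpow a z ** zpow b z.
Proof.
  move=> C; symmetry.
  apply: (zpow_unique _ (fun z => zpow a z ** zpow b z)) => [|n].
    by rewrite gmul1.
  by rewrite !zpow_succ -!gmulA (gmulA _ (zpow a n)) (C (zpow a n) b) -!gmulA.
Qed.

Lemma zpowJ {G : grp} (a g : G) z :
  zpow (g^- ** a ** g) z = g^- ** zpow a z ** g.
Proof.
  have fM : is_hom (fun a => g^- ** a ** g) by move=> u v; group_simp.
  by rewrite (hom_zpow (fun a => g^- ** a ** g)).
Qed.

(** * Subgroups, derived series and quotients *)

Lemma gen_sub {G : grp} (S T : G -> Prop) :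
  is_subgroup T -> (forall a, S a -> T a) -> forall a, gen S a -> T a.
Proof. by move=> [T1 [TM TV]] ST a; elim; auto. Qed.

Lemma gen_hom {G K : grp} (f : G -> K) (S : G -> Prop) (T : K -> Prop) :
  is_hom f -> (forall a, S a -> gen T (f a)) -> forall a, gen S a -> gen T (f a).
Proof.
  move=> fM ST; apply: gen_sub => //; split; last split.
  - by rewrite hom1 //; apply: gen_one.
  - by move=> a b; rewrite fM; apply: gen_mul.
  - by move=> a; rewrite (homV f) //; apply: gen_inv.
Qed.

Lemma hom_eq_on_gen {G K : grp} (f g : G -> K) (S : G -> Prop) :
  is_hom f -> is_hom g -> (forall a, S a -> f a = g a) ->
  forall a, gen S a -> f a = g a.
Proof.
  move=> fM gM; apply: (gen_sub S (fun a => f a = g a)); split; last split.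
  - by rewrite !hom1.
  - by move=> a b; rewrite fM gM => -> ->.
  - by move=> a; rewrite (homV f) // (homV g) // => ->.
Qed.

Lemma gen_cycle {G : grp} (h a : G) :
  gen (fun z => In z [h]) a -> exists j, a = zpow h j.
Proof.
  apply: (gen_sub _ (fun a => exists j, a = zpow h j)).
    split; first by exists 0%Z.
    split=> [_ _ [i ->] [j ->]|_ [i ->]].
      by exists (i + j)%Z; rewrite zpowD.
    by exists (- i)%Z; rewrite zpowN.
  by move=> _ [<-|[]]; exists 1%Z; rewrite zpow1.
Qed.

Lemma gen_is_subgroup {G : grp} (S : G -> Prop) : is_subgroup (gen S).
Proof. by split; [|split]; eauto using @gen. Qed.

Lemma subgroup_zpow {G : grp} (H : G -> Prop) h z :
  is_subgroup H -> H h -> H (zpow h z).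
Proof.
  move=> [H1 [HM HV]] Hh; elim/Z.peano_ind: z => [//|z IH|z IH].
    by rewrite zpow_succ; apply: HM.
  by rewrite /Z.pred zpowD (zpowN h 1) zpow1; apply: HM => //; apply: HV.
Qed.

(** [derived (S i)] is convertible to [commsub (derived i)], so facts about [commsub] apply directly
    to the derived series. *)
Definition commsub {G : grp} (S : G -> Prop) : G -> Prop :=
  gen (fun z => exists a b, S a /\ S b /\ z = gcomm a b).

Lemma commsub_hom {G K : grp} (f : G -> K) (S : G -> Prop) (T : K -> Prop) :
  is_hom f -> (forall a, S a -> T (f a)) ->
  forall a, commsub S a -> commsub T (f a).
Proof.
  move=> fM ST; apply: gen_hom => // _ [a [b [Sa [Sb ->]]]].
  apply: gen_base; exists (f a), (f b); split; first exact: ST.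
  by split; [exact: ST | rewrite /gcomm !fM !(homV f)].
Qed.

Lemma commsub_mono {G : grp} (S T : G -> Prop) :
  (forall a, S a -> T a) -> forall a, commsub S a -> commsub T a.
Proof. exact: (commsub_hom (fun a => a) S T (fun a b => eq_refl)). Qed.

Lemma commsub_sub {G : grp} (H : G -> Prop) :
  is_subgroup H -> forall a, commsub H a -> H a.
Proof.
  move=> HH; apply: gen_sub => // _ [a [b [Ha [Hb ->]]]].
  by move: HH => [_ [HM HV]]; rewrite /gcomm; auto.
Qed.

Lemma derived_subgroup {G : grp} i : is_subgroup (@derived G i).
Proof. by case: i => [|i]; [|exact: gen_is_subgroup]. Qed.

Lemma derived_hom {G K : grp} (f : G -> K) i :
  is_hom f -> forall a, derived i a -> derived i (f a).
Proof.
  move=> fM; elim: i => [//|i IH] a.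
  exact: (commsub_hom f (derived i) (derived i)).
Qed.

Lemma derived_conj {G : grp} i (g a : G) :
  derived i a -> derived i (g ** a ** g^-).
Proof.
  apply: (derived_hom (fun a => g ** a ** g^-)).
  by move=> u v; group_simp.
Qed.

Lemma derived_anti {G : grp} i j (a : G) :
  i <= j -> derived j a -> derived i a.
Proof.
  elim=> [//|k _ IH] Da; apply: IH.
  exact: (commsub_sub _ (derived_subgroup k)).
Qed.

(** Commutators lift entry by entry, and [s] need only be a section of sets. For [G -> G/G^(i)] this
    makes the [i]-th derived subgroup of the quotient trivial. *)
Lemma derived_surj {G K : grp} (f : G -> K) (s : K -> G) i :
  is_hom f -> (forall k, f (s k) = k) ->
  forall k, derived i k -> exists2 g, derived i g & f g = k.
Proof.
  move=> fM fs; elim: i => [k _|i IH]; first by exists (s k).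
  apply: (gen_sub _ (fun k => exists2 g, derived (S i) g & f g = k)).
    split; first by exists gone; [exact: gen_one | exact: hom1].
    split=> [_ _ [a Da <-] [b Db <-]|_ [a Da <-]].
      by exists (a ** b) => //; exact: gen_mul.
    by exists a^-; [exact: gen_inv | exact: homV].
  move=> _ [_ [_ [/IH[a Da <-] [/IH[b Db <-] ->]]]].
  exists (gcomm a b); last by rewrite /gcomm !fM !(homV f).
  by apply: gen_base; exists a, b.
Qed.

Lemma commsub_trivial {G : grp} (S : G -> Prop) :
  (forall a b, S a -> S b -> a ** b = b ** a) -> forall z, commsub S z -> z = gone.
Proof.
  move=> C; apply: gen_sub.
    by split; [|split] => [//|_ _ -> ->|_ ->]; group_simp.
  by move=> _ [a [b [Sa [Sb ->]]]]; apply/gcomm1; apply: C.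
Qed.

Definition normal_sub {G : grp} (N : G -> Prop) :=
  is_subgroup N /\ forall g a, N a -> N (g ** a ** g^-).

Lemma derived_normal {G : grp} i : normal_sub (@derived G i).
Proof. by split; [exact: derived_subgroup | exact: derived_conj]. Qed.

Section Quotient.
Context (G : grp) (N : G -> Prop) (NN : normal_sub N).

(** The chosen predicate depends only on the coset of [g], so by extensionality congruent elements
    get the same representative. The quotient is carried by the fixed points of [rep], which makes
    its equality plain equality. *)
Definition rep (g : G) : G := epsilon (inhabits gone) (fun z => N (z ** g^-)).

Lemma rep_spec g : N (rep g ** g^-).
Proof.
  apply: (epsilon_spec _ (fun z => N (z ** g^-))).
  by exists g; rewrite gmulrV; case: NN => [[? _] _].
Qed.

Lemma rep_eq a b : N (a ** b^-) -> rep a = rep b.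
Proof.
  case: NN => [[_ [NM NV]] _] Nab; rewrite /rep; f_equal.
  apply: functional_extensionality => z; apply: propositional_extensionality.
  split=> Nz.
    by move: (NM _ _ Nz Nab); group_simp.
  by move: (NM _ _ Nz (NV _ Nab)); group_simp.
Qed.

Lemma rep_eqE a b : rep a = rep b -> N (a ** b^-).
Proof.
  case: NN => [[_ [NM NV]] _] E.
  by move: (NM _ _ (NV _ (rep_spec a)) (rep_spec b)); rewrite E; group_simp.
Qed.

Definition qcar := {g : G | rep g = g}.

Lemma rep_rep g : rep (rep g) = rep g.
Proof. exact: rep_eq (rep_spec g). Qed.

Definition qproj (g : G) : qcar := exist _ (rep g) (rep_rep g).

Lemma qproj_eq a b : N (a ** b^-) -> qproj a = qproj b.
Proof.
  move=> /rep_eq E; rewrite /qproj; move: (rep_rep a) (rep_rep b).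
  by rewrite E => p1 p2; f_equal; apply: proof_irrelevance.
Qed.

Lemma qprojK (q : qcar) : qproj (proj1_sig q) = q.
Proof.
  case: q => g e; rewrite /qproj /=; move: (rep_rep g).
  by rewrite e => p; f_equal; apply: proof_irrelevance.
Qed.

Definition qmul (a b : qcar) := qproj (proj1_sig a ** proj1_sig b).
Definition qinv (a : qcar) := qproj (proj1_sig a)^-.

Lemma qmulE a b : qmul (qproj a) (qproj b) = qproj (a ** b).
Proof.
  case: NN => [[_ [NM NV]] NJ].
  apply: qproj_eq => /=.
  move: (NM _ _ (rep_spec a) (NJ a _ (rep_spec b))).
  by group_simp.
Qed.

Lemma qmulA a b c : qmul a (qmul b c) = qmul (qmul a b) c.
Proof. by rewrite -(qprojK a) -(qprojK b) -(qprojK c) !qmulE gmulA. Qed.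

Lemma qmul1 a : qmul (qproj gone) a = a.
Proof. by rewrite -(qprojK a) !qmulE gmul1. Qed.

Lemma qmulV a : qmul (qinv a) a = qproj gone.
Proof. by rewrite -{2}(qprojK a) /qinv qmulE gmulV. Qed.

Definition quot : grp := Grp qcar qmul qinv (qproj gone) qmulA qmul1 qmulV.

Lemma quotient_exists : exists (Q : grp) (p : G -> Q) (s : Q -> G),
  is_hom p /\ (forall q, p (s q) = q) /\ (forall g, p g = gone <-> N g).
Proof.
  exists quot, qproj, (@proj1_sig _ _); split; last split.
  - by move=> a b; rewrite /= qmulE.
  - exact: qprojK.
  - have e (g : G) : g ** gone^- = g by group_simp.
    move=> g; split=> [E|Ng].
      rewrite -(e g); apply: rep_eqE.
      exact: (f_equal (@proj1_sig _ _) E).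
    by apply: qproj_eq; rewrite e.
Qed.

End Quotient.

(** * Wreath products and the Magnus embedding *)

Definition zfun (I : Type) : grp.
Proof.
  refine (Grp (I -> Z) (fun f g i => (f i + g i)%Z) (fun f i => (- f i)%Z)
    (fun _ => 0%Z) _ _ _); intros; apply: functional_extensionality => j; lia.
Defined.

(* [Z^nat] wr [Q], with arbitrary rather than finitely supported functions in the
   base group. *)
Definition wreath (Q : grp) : grp.
Proof.
  refine (Grp ((Q -> nat -> Z) * Q)
    (fun u v => (fun q n => (fst u q n + fst v ((snd u)^- ** q) n)%Z,
                 snd u ** snd v))
    (fun u => (fun q n => (- fst u (snd u ** q) n)%Z, (snd u)^-))
    (fun _ _ => 0%Z, gone) _ _ _).
  - move=> [f a] [g b] [h c] /=; rewrite gmulA; f_equal.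
    apply: functional_extensionality => q; apply: functional_extensionality => n.
    by rewrite ginvM gmulA; lia.
  - move=> [f a] /=; rewrite gmul1; f_equal.
    apply: functional_extensionality => q; apply: functional_extensionality => n.
    by rewrite ginv1 gmul1.
  - move=> [f a] /=; rewrite gmulV; f_equal.
    apply: functional_extensionality => q; apply: functional_extensionality => n.
    by rewrite ginvK; lia.
Defined.

Lemma zfun_dl (I : Type) d : 1 <= d -> dl_le (G := zfun I) d.
Proof.
  move=> d1 g /(derived_anti 1 d g d1); apply: commsub_trivial => a b _ _.
  by apply: functional_extensionality => j /=; lia.
Qed.

(** The [i]-th derived subgroup projects to that of [Q], which is trivial, so it lies in the abelian
    base group; one more commutator step kills it. *)
Lemma wreath_dl (Q : grp) i d : i < d ->
  (forall q : Q, derived i q -> q = gone) -> dl_le (G := wreath Q) d.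
Proof.
  move=> id Q1 g /(derived_anti (S i) d g id).
  have sndM : is_hom (G := wreath Q) (K := Q) snd by [].
  apply: commsub_trivial => a b /(derived_hom _ i sndM)/Q1 a1.
  move=> /(derived_hom _ i sndM)/Q1 b1.
  case: a b a1 b1 => [f a] [g' b] /= -> ->; f_equal.
  apply: functional_extensionality => q; apply: functional_extensionality => n.
  by rewrite ginv1 gmul1; lia.
Qed.

(** The [m]-th basis vector of a free [Z[Q]]-module, with group ring elements written as functions
    on [Q]. *)
Definition delta {Q : grp} (m : nat) (q : Q) (n : nat) : Z :=
  if excluded_middle_informative (q = gone /\ n = m) is left _ then 1%Z else 0%Z.

(** The Magnus map sends [x m] to [(delta m, p (x m))]; it extends to [G] because the wreath product
    has derived length at most [i + 1 <= d]. Its first component [phi] collects the Fox derivatives: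
    [phi g q n] is the coefficient at [q] of the derivative of [g] in the [n]-th variable. *)
Lemma fox_exists (G Q : grp) (p : G -> Q) (s : Q -> G) r d x i :
  free_solvable G r d x -> i < d ->
  is_hom p -> (forall q, p (s q) = q) -> (forall g, p g = gone <-> derived i g) ->
  exists phi : G -> Q -> nat -> Z,
    (forall a b q n, phi (a ** b) q n = (phi a q n + phi b ((p a)^- ** q) n)%Z) /\
    (forall m, m < r -> phi (x m) = delta m).
Proof.
  move=> [_ [Ggen Guniv]] id pM ps pker.
  have Q1 (q : Q) : derived i q -> q = gone.
    by move=> /(derived_surj p s i pM ps) [g Dg <-]; apply/pker.
  have [F [FM Fx]] :=
    Guniv (wreath Q) (fun m => (delta m, p (x m))) (wreath_dl Q i d id Q1).
  have Fp g : snd (F g) = p g.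
    apply: (hom_eq_on_gen (K := Q) (fun g => snd (F g)) p _ _ pM _ g (Ggen g)).
      by move=> a b; rewrite FM.
    by move=> _ [m [mr ->]]; rewrite Fx.
  exists (fun g => fst (F g)); split=> [a b q n|m mr]; last by rewrite Fx.
  by rewrite FM /= Fp.
Qed.

(** * Closed edge chains cancel in commuting products *)

Section Chains.
Context (E : Type) (B : grp) (C : E -> B).
Context (CC : forall e e', C e ** C e' = C e' ** C e).

Definition letter (u : E * bool) : B :=
  if snd u then C (fst u) else (C (fst u))^-.

Definition chain_prod (l : list (E * bool)) : B :=
  fold_right (fun u b => letter u ** b) gone l.

Definition coef (e : E) (u : E * bool) : Z :=
  if excluded_middle_informative (fst u = e) is left _
  then if snd u then 1%Z else (-1)%Z else 0%Z.

Definition chain_coef (e : E) (l : list (E * bool)) : Z :=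
  fold_right (fun u z => (coef e u + z)%Z) 0%Z l.

Definition flip (u : E * bool) := (fst u, negb (snd u)).

Lemma chain_prod_app l1 l2 :
  chain_prod (l1 ++ l2) = chain_prod l1 ** chain_prod l2.
Proof. by elim: l1 => [|u l /= ->]; group_simp. Qed.

Lemma chain_coef_app e l1 l2 :
  chain_coef e (l1 ++ l2) = (chain_coef e l1 + chain_coef e l2)%Z.
Proof. elim: l1 => [|u l /= ->] //=; lia. Qed.

Lemma letter_flip u : letter (flip u) = (letter u)^-.
Proof. by case: u => e [] /=; rewrite /letter /= ?ginvK. Qed.

Lemma coef_flip e u : coef e (flip u) = (- coef e u)%Z.
Proof. by rewrite /coef /=; case: excluded_middle_informative; case: u => ? []. Qed.

Lemma chain_prod_rev l : chain_prod (rev (map flip l)) = (chain_prod l)^-.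
Proof.
  elim: l => [|u l IH] /=; first by group_simp.
  by rewrite chain_prod_app IH /= letter_flip; group_simp.
Qed.

Lemma chain_coef_rev e l : chain_coef e (rev (map flip l)) = (- chain_coef e l)%Z.
Proof.
  elim: l => [//|u l IH] /=.
  rewrite chain_coef_app IH /= coef_flip; lia.
Qed.

Lemma comm_inv (a b : B) : a ** b = b ** a -> a^- ** b = b ** a^-.
Proof.
  by move=> e; apply: (gmulI a); rewrite !gmulA e; group_simp.
Qed.

Lemma letter_comm u v : letter u ** letter v = letter v ** letter u.
Proof.
  rewrite /letter; case: (snd u); case: (snd v) => //.
  - by symmetry; apply: comm_inv.
  - by apply: comm_inv.
  - by apply: comm_inv; symmetry; apply: comm_inv.
Qed.

Lemma letter_chain_comm u l : letter u ** chain_prod l = chain_prod l ** letter u.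
Proof.
  elim: l => [|v l IH] /=; first by group_simp.
  by rewrite -gmulA -IH !gmulA letter_comm.
Qed.

(** If [flip u] were absent, every occurrence of the edge in [l] would carry the sign of [u], and
    the total could not have the opposite sign. *)
Lemma chain_coef_in u l :
  (chain_coef (fst u) l = - coef (fst u) u)%Z -> In (flip u) l.
Proof.
  case: u => e b /= E1; apply: NNPP => nI.
  have : (0 <= (if b then 1 else -1) * chain_coef e l)%Z.
    elim: l {E1} nI => [|[e' b'] l IH] /=; first by lia.
    move=> /not_or_and [n1 /IH]; rewrite /coef /=.
    case: excluded_middle_informative => [Ee|]; last by lia.
    by move: n1; rewrite /flip Ee /=; case: b {IH}; case: b' => n1;
      [lia | case: n1 | case: n1 | lia].
  move: E1; rewrite /coef /=.
  by case: excluded_middle_informative => // _; case: b {nI}; lia.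
Qed.

(** The inverse of the first letter occurs in the tail and can be commuted next to it. Removing the
    pair keeps all coefficients zero; two letters disappear, so the induction runs on a bound for
    the length. *)
Lemma chain_cancel l : (forall e, chain_coef e l = 0%Z) -> chain_prod l = gone.
Proof.
  move: (le_n (length l)); move: {2}(length l) => n.
  elim: n l => [|n IH] [|u l] //= ll E1; first by lia.
  have uI : In (flip u) l.
    by apply: chain_coef_in; move: (E1 (fst u)) => /=; lia.
  have [l1 [l2 El]] := in_split _ _ uI.
  rewrite El /= !chain_prod_app /= letter_flip !gmulA letter_chain_comm gmulK.
  rewrite -chain_prod_app; apply: IH.
    by move: ll; rewrite El /= !length_app /=; lia.
  move=> e; move: (E1 e); rewrite El /= !chain_coef_app /= coef_flip; lia.
Qed.

End Chains.
(** * Fox derivatives *)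

Section Fox.
Context (G Q : grp) (p : G -> Q) (s : Q -> G) (i r : nat) (x : nat -> G).
Context (pM : is_hom p) (ps : forall q, p (s q) = q).
Context (pker : forall g, p g = gone <-> derived i g).
Context (Ggen : forall g : G, gen (fun z => exists m, m < r /\ z = x m) g).
Context (phi : G -> Q -> nat -> Z).
Context (phiM : forall a b q n,
  phi (a ** b) q n = (phi a q n + phi b ((p a)^- ** q) n)%Z).
Context (phix : forall m, m < r -> phi (x m) = delta m).

Lemma phi1 q n : phi gone q n = 0%Z.
Proof.
  by move: (phiM gone gone q n); rewrite gmul1 (hom1 p) // ginv1 gmul1; lia.
Qed.

Lemma phiV a q n : phi a^- q n = (- phi a (p a ** q) n)%Z.
Proof.
  move: (phiM a^- a q n); rewrite gmulV phi1 (homV p) // ginvK; lia.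
Qed.

(* Fix a transversal [s] of [G^(i)].  A word traces a path in the Cayley graph
   of [G/G^(i)], the edge from [q] to [q x_m] contributes the element
   [s(q) x_m s(q x_m)^-1] of the abelian group [G^(i)/G^(i+1)], and [phi]
   counts the signed number of passages through each edge. *)
Lemma fox_chain (B : grp) (p' : G -> B) (g : G) : is_hom p' -> forall q : Q,
  exists l : list ((Q * nat) * bool),
    (forall e, chain_coef _ e l = phi g (q^- ** fst e) (snd e)) /\
    chain_prod _ B
      (fun e => p' (s (fst e) ** x (snd e) ** (s (fst e ** p (x (snd e))))^-)) l =
    p' (s q ** g ** (s (q ** p g))^-).
Proof.
  move=> pM'.
  elim: (Ggen g) => {g} [_ [m [mr ->]] q| q|a b _ Pa _ Pb q|a _ Pa q].
  - exists [((q, m), true)]; split=> [[q' n]|] /=.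
      rewrite phix // /coef /delta /=.
      case: excluded_middle_informative => [[<- <-]|ne];
        case: excluded_middle_informative => // -[].
        by rewrite gmulV.
      move=> e mn; case: ne; rewrite mn; f_equal.
      by apply: (gmulI q^-); rewrite e gmulV.
    by rewrite /letter /= gmulr1.
  - exists []; split=> [e|] /=; first by rewrite phi1.
    by rewrite (hom1 p) // !gmulr1 gmulrV hom1.
  - have [la [ca pa]] := Pa q; have [lb [cb pb]] := Pb (q ** p a).
    exists (la ++ lb); split=> [e|].
      by rewrite chain_coef_app ca cb phiM ginvM gmulA.
    rewrite chain_prod_app pa pb -pM' pM; f_equal.
    by group_simp.
  (* The path of [a^-] from [q] is the path of [a] that ends at [q], traversed backwards. *)
  - have [la [ca pa]] := Pa (q ** (p a)^-).
    exists (rev (map (flip _) la)); split=> [e|].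
      by rewrite chain_coef_rev ca phiV ginvM ginvK gmulA.
    rewrite chain_prod_rev pa -(homV p') // (homV p) //; f_equal.
    by group_simp.
Qed.

(** Injectivity of the Magnus map on [G^(i)/G^(i+1)]. The path of [g] from the identity is closed
    and passes every edge with total count zero, so its product of edge elements cancels in an
    abelian group. This product is a conjugate of the image of [g]. *)
Lemma fox_inj g :
  derived i g -> (forall q n, phi g q n = 0%Z) -> derived (S i) g.
Proof.
  move=> Dg g0.
  have [B [p' [s' [pM' [_ pker']]]]] := quotient_exists G _ (derived_normal (S i)).
  apply/pker'.
  have [l [cl pl]] := fox_chain B p' g pM' gone.
  have E : p' (s gone ** g ** (s gone)^-) = gone.
    move: pl; rewrite gmul1 (proj2 (pker g)) // => <-.
    apply: chain_cancel => [e e'|e]; last by rewrite cl g0.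
    (* Edge elements lie in [G^(i)] since [s] is a section of [p]; their images modulo [G^(i+1)]
       therefore commute. *)
    have D (q : Q) (m : nat) : derived i (s q ** x m ** (s (q ** p (x m)))^-).
      by apply/pker; rewrite !pM (homV p) // !ps gmulrV.
    have comm a b : derived i a -> derived i b -> p' a ** p' b = p' b ** p' a.
      move=> Da Db; apply/gcomm1; rewrite /gcomm -!(homV p') // -!pM'.
      by apply/pker'; apply: gen_base; exists a, b.
    by apply: comm; apply: D.
  move: E; rewrite !pM' (homV p') // => E.
  apply: (gmulI (p' (s gone))); rewrite gmulr1.
  exact: gmulV1_eq.
Qed.

(** This recovers the finite support of Fox derivatives along each orbit of [t], as the base
    functions of the wreath product are arbitrary. A generator is supported at one point, which an
    orbit of [t] meets for at most one exponent. The induction varies [t] because the translation in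
    the product rule replaces it by a conjugate. *)
Lemma phi_orbit_finite g (t : Q) : (forall z, zpow t z = gone -> z = 0%Z) ->
  forall q n, exists b, forall z, (b < Z.abs z)%Z -> phi g (zpow t z ** q) n = 0%Z.
Proof.
  have translate (a : Q) (t' : Q) z (q : Q) :
    a ** (zpow t' z ** q) = zpow (a^-^- ** t' ** a^-) z ** (a ** q).
    by rewrite zpowJ; group_simp.
  have torsfree (a t' : Q) : (forall z, zpow t' z = gone -> z = 0%Z) ->
    forall z, zpow (a^-^- ** t' ** a^-) z = gone -> z = 0%Z.
    move=> tf z; rewrite zpowJ ginvK => e; apply: tf.
    by apply: (gmulI a); rewrite gmulr1; apply: gmulV1_eq.
  elim: (Ggen g) t => {g} [_ [m [mr ->]] t tf q n|t tf q n|a b _ Pa _ Pb t tf q n|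
      a _ Pa t tf q n].
  - rewrite phix //.
    case: (classic (exists z, zpow t z ** q = gone)) => [[z0 e0]|ne].
      exists (Z.abs z0) => z hz; rewrite /delta.
      case: excluded_middle_informative => // -[ez _].
      suff : (z - z0 = 0)%Z by lia.
      apply: tf; rewrite /Z.sub zpowD zpowN.
      have -> : zpow t z = q^- by rewrite -(gmulK (zpow t z) q) ez gmul1.
      have -> : zpow t z0 = q^- by rewrite -(gmulK (zpow t z0) q) e0 gmul1.
      by group_simp.
    exists 0%Z => z _; rewrite /delta.
    by case: excluded_middle_informative => // -[ez _]; case: ne; exists z.
  - by exists 0%Z => z _; rewrite phi1.
  - have [ba Ha] := Pa t tf q n.
    have [bb Hb] := Pb _ (torsfree (p a)^- t tf) ((p a)^- ** q) n.
    exists (Z.max ba bb) => z hz.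
    by rewrite phiM translate Ha ?Hb //; lia.
  - have [b Hb] := Pa _ (torsfree (p a) t tf) (p a ** q) n.
    by exists b => z hz; rewrite phiV translate Hb.
Qed.

Lemma phi_sub u v : p u = gone -> p v = gone -> forall q n,
  phi (u ** v) q n = (phi u q n + phi v q n)%Z.
Proof. by move=> pu pv q n; rewrite phiM pu ginv1 gmul1. Qed.

(** The two terms from [g] and [g^-] cancel, so conjugation becomes translation: this is the
    [Z[Q]]-module structure on the kernel of [p]. *)
Lemma phi_conj g u : p u = gone -> forall q n,
  phi (g ** u ** g^-) q n = phi u ((p g)^- ** q) n.
Proof.
  move=> pu q n; rewrite !phiM phiV pM pu gmulr1 gmulA gmulrV gmul1; lia.
Qed.

(* An element of a free [Z[t,t^-1]]-module divisible by every power of [t - 1]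
   vanishes: division by [t - 1] shortens supports. *)
Lemma divisible_vanish (D : G -> Prop) (t : Q) :
  (forall z, zpow t z = gone -> z = 0%Z) ->
  (forall u, D u -> exists2 v, D v & forall q n,
     phi u q n = (phi v (t^- ** q) n - phi v q n)%Z) ->
  forall u, D u -> forall q n, phi u q n = 0%Z.
Proof.
  move=> tf Ddiv u Du q n.
  (* Induction on the length [k] of a window of exponents [j] that contains the support of [u] on
     the orbit of [q]. *)
  have short k : forall a u, D u ->
    (forall j, phi u (zpow t j ** q) n <> 0%Z -> (a <= j < a + Z.of_nat k)%Z) ->
    forall j, phi u (zpow t j ** q) n = 0%Z.
    elim: k => [|k IH] a {}u {}Du supp j.
      by apply: NNPP => /supp; lia.
    have [v Dv Ev] := Ddiv u Du.
    have Ej j' : phi u (zpow t j' ** q) n =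
        (phi v (zpow t (j' - 1) ** q) n - phi v (zpow t j' ** q) n)%Z.
      by rewrite Ev gmulA; do 4 f_equal; rewrite Z.sub_1_r -{1}(Z.succ_pred j')
        zpow_succ gmulA gmulV gmul1.
    have [b Hb] := phi_orbit_finite v t tf q n.
    suff v0 : forall j, phi v (zpow t j ** q) n = 0%Z by rewrite Ej !v0.
    apply: (IH a v Dv) => j' /= nz.
    (* Where [u] vanishes, [v] takes equal values at [j - 1] and [j]; a nonzero value left of the
       window would propagate to minus infinity. *)
    have left k' : (j' < a)%Z -> phi v (zpow t (j' - Z.of_nat k') ** q) n <> 0%Z.
      move=> lt; elim: k' => [|k' IHk]; first by rewrite Z.sub_0_r.
      move=> e; apply: IHk; apply: NNPP => ne.
      have /supp : phi u (zpow t (j' - Z.of_nat k') ** q) n <> 0%Z.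
        rewrite Ej.
        have -> : (j' - Z.of_nat k' - 1 = j' - Z.of_nat (S k'))%Z by lia.
        lia.
      lia.
    (* The value of [u] at [j + 1] compares [v] at [j] and [j + 1], so the propagation to the right
       already starts at [a + k], the last place of the window of [u]. This gains the one place by
       which the window of [v] is shorter. *)
    have right k' : (a + Z.of_nat k <= j')%Z ->
        phi v (zpow t (j' + Z.of_nat k') ** q) n <> 0%Z.
      move=> lt; elim: k' => [|k' IHk]; first by rewrite Z.add_0_r.
      move=> e; apply: IHk; apply: NNPP => ne.
      have /supp : phi u (zpow t (j' + Z.of_nat (S k')) ** q) n <> 0%Z.
        rewrite Ej.
        have -> : (j' + Z.of_nat (S k') - 1 = j' + Z.of_nat k')%Z by lia.
        lia.
      lia.
    pose K := Z.to_nat (Z.abs b + Z.abs j' + 1).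
    split; apply: NNPP => ne.
      by apply: (left K); [lia | apply: Hb; lia].
    by apply: (right K); [lia | apply: Hb; lia].
  have [b Hb] := phi_orbit_finite u t tf q n.
  rewrite -(gmul1 _ q).
  (* The initial window holds the [2|b| + 1] exponents of absolute value at most [|b|]; exponent [0]
     gives the point [q] itself. *)
  apply: (short (Z.to_nat (2 * Z.abs b + 1)) (- Z.abs b)%Z u Du _ 0%Z) => j nz.
  apply: NNPP => out; apply: nz; apply: Hb; lia.
Qed.

(** * Divisibility of the commutator subgroup by [t - 1] *)

Section CommutatorSubgroup.
Context (H : G -> Prop) (HH : is_subgroup H) (h : G) (Hh : H h).
Context (Hdec : forall y, H y -> exists j v, commsub H v /\ y = v ** zpow h j).
Context (Hker : forall u, commsub H u -> p u = gone).

Lemma commsubJ j v : commsub H v -> commsub H (zpow h j ** v ** zpow h (- j)).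
Proof.
  move: HH => [_ [HM HV]]; have Hj z := subgroup_zpow H h z HH Hh.
  rewrite zpowN; apply: (commsub_hom (fun v => zpow h j ** v ** (zpow h j)^-)).
    by move=> a b; group_simp.
  by move=> a Ha; exact: (HM _ _ (HM _ _ (Hj _) Ha) (HV _ (Hj _))).
Qed.

Lemma phi_commsubJ j v q n : commsub H v ->
  phi (zpow h j ** v ** zpow h (- j)) q n = phi v (zpow (p h) (- j) ** q) n.
Proof. by move=> Dv; rewrite !zpowN (phi_conj _ _ (Hker _ Dv)) (hom_zpow p). Qed.

Lemma phi_commsubM u v q n : commsub H u -> commsub H v ->
  phi (u ** v) q n = (phi u q n + phi v q n)%Z.
Proof. by move=> Du Dv; apply: phi_sub; apply: Hker. Qed.

Lemma phi_commsubV u q n : commsub H u -> phi u^- q n = (- phi u q n)%Z.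
Proof. by move=> Du; rewrite phiV (Hker _ Du) gmul1. Qed.

(* [t^k - 1] is a multiple of [t - 1]. *)
Lemma power_difference k v : commsub H v -> exists2 w, commsub H w & forall q n,
  (phi v (zpow (p h) k ** q) n - phi v q n =
   phi w ((p h)^- ** q) n - phi w q n)%Z.
Proof.
  move=> Dv; elim/Z.peano_ind: k => [|k [w Dw Ew]|k [w Dw Ew]].
  - by exists gone => [|q n]; [exact: gen_one | rewrite gmul1 !phi1; lia].
  - exists (w ** (zpow h (- Z.succ k) ** v ** zpow h (- - Z.succ k))^-).
      by apply: gen_mul => //; apply: gen_inv; apply: commsubJ.
    have Dv' := commsubJ (- Z.succ k) v Dv.
    move=> q n; rewrite !(phi_commsubM w) //; try by apply: gen_inv.
    rewrite !phi_commsubV // !phi_commsubJ // Z.opp_involutive.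
    have -> : zpow (p h) (Z.succ k) ** ((p h)^- ** q) = zpow (p h) k ** q.
      by rewrite -Z.add_1_r zpowD zpow1; group_simp.
    by move: (Ew q n); lia.
  - exists (w ** (zpow h (- k) ** v ** zpow h (- - k))).
      by apply: gen_mul => //; apply: commsubJ.
    have Dv' := commsubJ (- k) v Dv.
    move=> q n; rewrite !(phi_commsubM w) // !phi_commsubJ // Z.opp_involutive.
    have -> : zpow (p h) k ** ((p h)^- ** q) = zpow (p h) (Z.pred k) ** q.
      by rewrite -{1}(Z.succ_pred k) -Z.add_1_r zpowD zpow1; group_simp.
    by move: (Ew q n); lia.
Qed.

(** For [a = v1 h^j] and [b = v2 h^k], the product rule is applied to [a b = b a [a, b]]. Up to a
    translation by [p (b a)], the commutator contributes [(t^j - 1) v2 - (t^k - 1) v1], where [t] is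
    the action of [h]; [power_difference] turns both terms into multiples of [t - 1]. *)
Lemma commsub_divisible u : commsub H u -> exists2 v, commsub H v & forall q n,
  phi u q n = (phi v ((p h)^- ** q) n - phi v q n)%Z.
Proof.
  pose P u := exists2 v, commsub H v & forall q n,
    phi u q n = (phi v ((p h)^- ** q) n - phi v q n)%Z.
  (* Membership is carried through the induction because additivity of [phi] is available on
     [commsub H], which [p] kills. *)
  move=> Du; suff [//] : P u /\ commsub H u.
  move: u Du; apply: (gen_sub _ (fun u => P u /\ commsub H u)).
    split; first split; [|exact: gen_one|].
      by exists gone => [|q n]; [exact: gen_one | rewrite !phi1].
    split=> [a b [[v Dv Ev] Da] [[w Dw Ew] Db]|a [[v Dv Ev] Da]].
      split; last exact: gen_mul.
      exists (v ** w) => [|q n]; first exact: gen_mul.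
      by rewrite !phi_commsubM // Ev Ew; lia.
    split; last exact: gen_inv.
    exists v^- => [|q n]; first exact: gen_inv.
    by rewrite !phi_commsubV // Ev; lia.
  move=> _ [a [b [Ha [Hb ->]]]].
  have Dc : commsub H (gcomm a b) by apply: gen_base; exists a, b.
  split=> //.
  have [j [v1 [D1 aE]]] := Hdec a Ha; have [k [v2 [D2 bE]]] := Hdec b Hb.
  have [w1 Dw1 E1] := power_difference (- k) v1 D1.
  have [w2 Dw2 E2] := power_difference (- j) v2 D2.
  pose w := w1^- ** w2.
  have Dw : commsub H w by apply: gen_mul => //; apply: gen_inv.
  (* This conjugation of [w] accounts for the translation by [p (b a)], which equals [p h] to the
     power [j + k]. *)
  exists (zpow h (- (j + k)) ** w ** zpow h (- - (j + k))).
    exact: commsubJ.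
  move=> q n; rewrite !phi_commsubJ // Z.opp_involutive.
  set t := zpow (p h) (j + k).
  have tC : t ** ((p h)^- ** q) = (p h)^- ** (t ** q).
    have -> : (p h)^- = zpow (p h) (-1) by rewrite (zpowN _ 1) zpow1.
    by rewrite (gmulA _ t) (gmulA _ _ t) /t zpowC.
  rewrite tC /w !(phi_commsubM w1^-) //; try by apply: gen_inv.
  rewrite !phi_commsubV //.
  have pab : p (b ** a) = t.
    rewrite aE bE !pM (Hker v1) // (Hker v2) // !gmul1 !(hom_zpow p) // zpowC /t zpowD //.
  have abE : phi (a ** b) (t ** q) n = phi (b ** a ** gcomm a b) (t ** q) n.
    by f_equal; rewrite /gcomm; group_simp.
  move: abE; rewrite (phiM (b ** a)) pab gmulA gmulV gmul1 aE bE.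
  rewrite !phiM.
  rewrite ?pM (Hker v1) // (Hker v2) // ?ginvM ?ginv1 ?gmul1 ?gmulr1.
  rewrite !(hom_zpow p) // -!zpowN.
  (* The terms coming from powers of [h] alone cancel, because these powers commute. *)
  have := f_equal (fun g => phi g (t ** q) n) (zpowC h j k).
  rewrite !phiM !(hom_zpow p) // -!zpowN.
  have := E1 (t ** q) n; have := E2 (t ** q) n.
  lia.
Qed.

End CommutatorSubgroup.

End Fox.
(** * Words and verbal closure *)

Fixpoint wren (f : nat -> nat) (w : word) : word :=
  match w with
  | wvar i => wvar (f i)
  | wone => wone
  | wmul u v => wmul (wren f u) (wren f v)
  | winv u => winv (wren f u)
  end.

Lemma weval_wren {G : grp} (a : nat -> G) f w :
  weval a (wren f w) = weval (fun i => a (f i)) w.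
Proof. by elim: w => //= [u -> v ->|u ->]. Qed.

Definition wpow (k : nat) (w : word) : word := Nat.iter k (wmul w) wone.

Lemma weval_wpow {G : grp} (a : nat -> G) k w :
  weval a (wpow k w) = zpow (weval a w) (Z.of_nat k).
Proof. by elim: k => [//|k IH]; rewrite Nat2Z.inj_succ zpow_succ -IH. Qed.

(** Serves to give two words disjoint sets of variables. *)
Lemma interleave {T : Type} (a b : nat -> T) :
  exists c : nat -> T, (forall i, c (2 * i) = a i) /\ forall i, c (S (2 * i)) = b i.
Proof.
  exists (fun n => if Nat.even n then a (Nat.div2 n) else b (Nat.div2 n)).
  split=> i; first by rewrite Nat.even_mul Nat.div2_double.
  by rewrite Nat.even_succ Nat.odd_mul Nat.div2_succ_double.
Qed.

Lemma weval_ext {G : grp} (a b : nat -> G) w :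
  (forall i, a i = b i) -> weval a w = weval b w.
Proof. by move=> E; elim: w => //= [u -> v ->|u ->]. Qed.

(** The shape of a product of commutators is recorded by a word all of whose values are again
    products of commutators. Hence a solution in [H], supplied by verbal closure, takes its value in
    [H']. *)
Lemma commsub_word {G : grp} (S : G -> Prop) c : commsub S c ->
  exists w a, weval a w = c /\
    forall (b : nat -> G) (T : G -> Prop),
      (forall i, T (b i)) -> commsub T (weval b w).
Proof.
  elim=> {c} [_ [a [b [_ [_ ->]]]]| |a b _ [u [f [<- fT]]] _ [v [g [<- gT]]]|
      a _ [u [f [<- fT]]]].
  - exists (wmul (wmul (winv (wvar 0)) (winv (wvar 1))) (wmul (wvar 0) (wvar 1))).
    exists (fun n => match n with 0 => a | _ => b end); split=> // f T Tf.
    by apply: gen_base; exists (f 0), (f 1).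
  - by exists wone, (fun _ => gone); split=> // *; apply: gen_one.
  - have [h [hf hg]] := interleave f g.
    exists (wmul (wren (fun i => 2 * i) u) (wren (fun i => Datatypes.S (2 * i)) v)), h.
    split=> [|b' T Tb] /=; rewrite !weval_wren.
      by rewrite (weval_ext _ _ u hf) (weval_ext _ _ v hg).
    by apply: gen_mul; [apply: fT | apply: gT].
  - by exists (winv u), f; split=> // *; apply: gen_inv; apply: fT.
Qed.

(** Verbal closure for the word [z^k w], with variable [0] as [z] and the variables of the
    commutator word [w] shifted by one. *)
Lemma vc_power_comm {G : grp} (H : G -> Prop) h g c k :
  verbally_closed H -> H h -> derived 1 c -> h = zpow g (Z.of_nat k) ** c ->
  exists b c', H b /\ commsub H c' /\ h = zpow b (Z.of_nat k) ** c'.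
Proof.
  move=> vc Hh /commsub_word [w [a [<- wT]]] hE.
  have [|b [Hb <-]] := vc (wmul (wpow k (wvar 0)) (wren S w)) h Hh.
    exists (fun n => match n with 0 => g | S n => a n end).
    by rewrite /= weval_wren weval_wpow hE.
  exists (b 0), (weval (fun i => b (S i)) w); split; first exact: Hb.
  by split; [apply: wT | rewrite /= weval_wren weval_wpow].
Qed.

(** * Exponent sums *)

Section Additive.
Context (G : grp) (e : G -> Z) (eM : forall a b, e (a ** b) = (e a + e b)%Z).

Lemma additive1 : e gone = 0%Z.
Proof. by move: (eM gone gone); rewrite gmul1; lia. Qed.

Lemma additiveV a : e a^- = (- e a)%Z.
Proof. by move: (eM a a^-); rewrite gmulrV additive1; lia. Qed.

Lemma additive_zpow a z : e (zpow a z) = (z * e a)%Z.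
Proof.
  elim/Z.peano_ind: z => [|z IH|z IH]; first exact: additive1.
    by rewrite zpow_succ eM IH; lia.
  by move: IH; rewrite -{1}(Z.succ_pred z) zpow_succ eM; lia.
Qed.

Lemma additive_derived a : derived 1 a -> e a = 0%Z.
Proof.
  apply: (gen_sub _ (fun a => e a = 0%Z)).
    split; first exact: additive1.
    by split=> [u v|u]; rewrite ?eM ?additiveV; lia.
  by move=> _ [u [v [_ [_ ->]]]]; rewrite /gcomm !eM !additiveV; lia.
Qed.

End Additive.

Fixpoint dot (b a : nat -> Z) (r : nat) : Z :=
  match r with 0 => 0%Z | S r => (dot b a r + b r * a r)%Z end.

Lemma dot_scale u b a r : dot (fun n => u * b n)%Z a r = (u * dot b a r)%Z.
Proof. elim: r => [|r IH] /=; lia. Qed.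

Lemma dot_ext b b' a r : (forall n, n < r -> b n = b' n) -> dot b a r = dot b' a r.
Proof. by elim: r => [//|r IH E] /=; rewrite IH ?E; auto. Qed.

Lemma dot_add b a a' r :
  dot b (fun n => a n + a' n)%Z r = (dot b a r + dot b a' r)%Z.
Proof. elim: r => [|r IH] /=; lia. Qed.

Lemma bezout_vector (a : nat -> Z) r :
  exists (k : nat) b, (forall n, n < r -> (Z.of_nat k | a n)%Z) /\
    dot b a r = Z.of_nat k.
Proof.
  elim: r => [|r [k [b [kd kE]]]]; first by exists 0, a; split=> // n; lia.
  have [u [v E]] := Z.gcd_bezout (Z.of_nat k) (a r) _ eq_refl.
  exists (Z.to_nat (Z.gcd (Z.of_nat k) (a r))).
  (* With [u k + v a_r] the new gcd, the old coefficients are scaled by [u] and the new coordinate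
     gets [v]. *)
  exists (fun n => if Nat.eqb n r then v else (u * b n)%Z).
  rewrite (Z2Nat.id _ (Z.gcd_nonneg _ _)).
  split=> [n nr|/=].
    case: (Nat.eq_dec n r) => [->|ne]; first exact: Z.gcd_divide_r.
    by apply: Z.divide_trans (Z.gcd_divide_l _ _) (kd n _); lia.
  rewrite Nat.eqb_refl -E -kE -dot_scale; f_equal.
  by apply: dot_ext => n nr; case: Nat.eqb_spec => //; lia.
Qed.

Fixpoint monomial {B : grp} (y : nat -> B) (a : nat -> Z) (r : nat) : B :=
  match r with 0 => gone | S r => monomial y a r ** zpow (y r) (a r) end.

Lemma monomial_add {B : grp} (y : nat -> B) a b r :
  (forall u v : B, u ** v = v ** u) ->
  monomial y (fun n => a n + b n)%Z r = monomial y a r ** monomial y b r.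
Proof.
  move=> C; elim: r => [|r /= ->]; first by group_simp.
  rewrite zpowD !gmulA; f_equal; rewrite -!gmulA; f_equal; exact: C.
Qed.

Lemma monomial_scale {B : grp} (y : nat -> B) a b z r :
  (forall u v : B, u ** v = v ** u) -> (forall n, n < r -> a n = (b n * z)%Z) ->
  monomial y a r = zpow (monomial y b r) z.
Proof.
  move=> C; elim: r => [_|r IH E] /=.
    by symmetry; rewrite -(zpowM gone 0 z).
  by rewrite zpow_commM // -zpowM -E ?IH //; auto.
Qed.

Definition unit_vec (m n : nat) : Z := if Nat.eqb n m then 1%Z else 0%Z.

Lemma monomial_unit {B : grp} (y : nat -> B) m r :
  monomial y (unit_vec m) r = if Nat.ltb m r then y m else gone.
Proof.
  elim: r => [//|r IH] /=; rewrite IH /unit_vec.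
  case: Nat.ltb_spec; case: Nat.eqb_spec; case: Nat.ltb_spec; try lia.
  - by move=> *; group_simp.
  - by move=> _ -> _; rewrite zpow1 gmul1.
  - by move=> *; group_simp.
Qed.

(* [k] is the gcd of the exponent sums of [h]. *)
Lemma primitive_root (G : grp) r d x (h : G) :
  free_solvable G r d x -> 1 <= d ->
  exists (k : nat) (g c : G) (e : G -> Z),
    (forall a b, e (a ** b) = (e a + e b)%Z) /\ e h = Z.of_nat k /\
    derived 1 c /\ h = zpow g (Z.of_nat k) ** c.
Proof.
  move=> [_ [Ggen Guniv]] d1.
  (* [eps] is the vector of exponent sums. *)
  have [eps [epsM epsx]] := Guniv (zfun nat) unit_vec (zfun_dl nat d d1).
  have [B [p [s [pM [ps pker]]]]] := quotient_exists G _ (derived_normal 1).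
  have C (u v : B) : u ** v = v ** u.
    rewrite -(ps u) -(ps v); apply/gcomm1.
    rewrite /gcomm -!(homV p) // -!pM; apply/pker; apply: gen_base.
    by exists (s u), (s v).
  have pE g : p g = monomial (fun n => p (x n)) (eps g) r.
    apply: (hom_eq_on_gen p (fun g => monomial (fun n => p (x n)) (eps g) r) _ pM _ _
      _ (Ggen g)).
      by move=> a b; rewrite -monomial_add // epsM.
    move=> _ [m [mr ->]]; rewrite epsx // monomial_unit.
    by case: Nat.ltb_spec => //; lia.
  have [k [b [kd kE]]] := bezout_vector (eps h) r.
  pose root := monomial (fun n => p (x n)) (fun n => eps h n / Z.of_nat k)%Z r.
  exists k, (s root), ((zpow (s root) (Z.of_nat k))^- ** h), (fun g => dot b (eps g) r).
  split; [|split; [by []|split]].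
  - by move=> u v; rewrite epsM -dot_add.
  - apply/pker; rewrite pM (homV p) // (hom_zpow p) // ps pE.
    rewrite (monomial_scale _ (eps h) (fun n => eps h n / Z.of_nat k)%Z (Z.of_nat k)) //;
      last by rewrite gmulV.
    move=> n nr; case: (kd n nr) => z ->.
    (* For [k = 0] the exponent sums of [h] are all zero, so the value of the division by zero does
       not matter. *)
    case: (Z.eq_dec (Z.of_nat k) 0) => [->|nz]; first by lia.
    by rewrite Z.div_mul.
  - by rewrite gmulA gmulrV gmul1.
Qed.

(** * Descent through the derived series and the retraction *)

(** The case of exponent [0], where the power factor is trivial. *)
Lemma vc_commsub {G : grp} (H : G -> Prop) y :
  verbally_closed H -> H y -> derived 1 y -> commsub H y.
Proof.
  move=> vc Hy Dy.
  have [//|b [c [_ [Dc ->]]]] := vc_power_comm H y gone y 0 vc Hy Dy.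
    by rewrite gmul1.
  by rewrite gmul1.
Qed.

(** One step of the descent. The bound [1 <= i] makes [h] of infinite order modulo [G^(i)], and
    [i < d] makes the Magnus map available. *)
Lemma commsub_layer (G : grp) r d x (H : G -> Prop) h i :
  free_solvable G r d x -> is_subgroup H -> H h ->
  (forall y, H y -> exists j v, commsub H v /\ y = v ** zpow h j) ->
  (forall z, derived 1 (zpow h z) -> z = 0%Z) ->
  1 <= i < d -> (forall u, commsub H u -> derived i u) ->
  forall u, commsub H u -> derived (S i) u.
Proof.
  move=> FS HH Hh Hdec tf [i1 id] Di u Du.
  have [Q [p [s [pM [ps pker]]]]] := quotient_exists G _ (derived_normal i).
  have [phi [phiM phix]] := fox_exists G Q p s r d x i FS id pM ps pker.
  have Ggen := proj1 (proj2 FS).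
  apply: (fox_inj G Q p s i r x pM ps pker Ggen phi phiM phix); first exact: Di.
  apply: (divisible_vanish G Q p r x pM Ggen phi phiM phix (commsub H) (p h)) => //.
    move=> z e; apply: tf; apply: (derived_anti 1 i) => //.
    by apply/pker; rewrite (hom_zpow p).
  apply: (commsub_divisible G Q p pM phi phiM H HH h Hh Hdec).
  by move=> v Dv; apply/pker; apply: Di.
Qed.

Theorem theorem1 (r d : nat) (hr : 1 <= r) (hd : 1 <= d)
  (G : grp) (x : nat -> G) (hG : free_solvable G r d x)
  (H : G -> Prop) (hH : is_subgroup H) (hfg : fin_gen H)
  (hvc : verbally_closed H) (hab : rab_eq H 1) :
  is_retract H.
Proof.
  have [[l [l1 [Hl hl]]] hmin] := hab.
  case: l l1 Hl hl => [//|h [_|//]] Hl hl.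
  have Hh : H h by apply: Hl; left.
  have [_ [HM HV]] := hH.
  have mod_h y : H y -> exists j, derived 1 (y ** (zpow h j)^-).
    by move=> /hl [w [/gen_cycle [j ->] D]]; exists j.
  have [k [g [c [e [eM [eh [Dc hE]]]]]]] := primitive_root G r d x h hG hd.
  (* For [k = 0] the element [h] lies in [G'], so the empty list generates [H] modulo [G'], against
     rank [1]. *)
  have k0 : k <> 0.
    move=> k0; move: hE; rewrite k0 gmul1 => hE.
    suff /hmin /Nat.nle_succ_0 : rab_gen H [] by [].
    split=> // y /mod_h [j D]; exists gone; split; first exact: gen_one.
    rewrite ginv1 gmulr1 -(gmulVK y (zpow h j)); apply: gen_mul => //.
    by apply: subgroup_zpow; [exact: gen_is_subgroup | rewrite hE].
  (* Verbal closure gives [h = b^k c'] with [b] in [H], hence [e b = 1]; as [b] is [h^j] modulo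
     [G'], also [e b = j k], which forces [k = 1]. *)
  have e1 : e h = 1%Z.
    have [b [c' [Hb [/(commsub_mono _ (derived 0)) Dc' hE']]]] :=
      vc_power_comm H h g c k hvc Hh Dc hE.
    have [j /(additive_derived G e eM)] := mod_h b Hb.
    rewrite eM (additiveV G e eM) !(additive_zpow G e eM) eh => eb.
    have : e h = (Z.of_nat k * e b)%Z.
      rewrite {1}hE' eM (additive_zpow G e eM).
      by rewrite (additive_derived G e eM c' (Dc' (fun _ _ => I))) Z.add_0_r.
    rewrite eh => E.
    have b1 : e b = 1%Z by apply: (Z.mul_reg_l _ _ (Z.of_nat k)); lia.
    have := Z.eq_mul_1_nonneg (Z.of_nat k) j; lia.
  have Hdec y : H y -> exists j v, commsub H v /\ y = v ** zpow h j.
    move=> Hy; have [j D] := mod_h y Hy; exists j, (y ** (zpow h j)^-).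
    split; last by rewrite gmulVK.
    apply: vc_commsub => //; apply: HM => //; apply: HV.
    exact: subgroup_zpow.
  have tf z : derived 1 (zpow h z) -> z = 0%Z.
    by move=> /(additive_derived G e eM); rewrite (additive_zpow G e eM) e1; lia.
  (* The descent starts from [H'] inside [G'] and stops at [G^(d)], which is trivial. *)
  have layers i : S i <= d -> forall u, commsub H u -> derived (S i) u.
    elim: i => [_|i IH id]; first exact: (commsub_mono _ (derived 0)).
    by apply: (commsub_layer G r d x H h) => //; [lia | apply: IH; lia].
  have D1 u : commsub H u -> u = gone.
    move=> Du; apply: (proj1 hG); move: (layers (pred d)).
    by rewrite (Nat.succ_pred_pos d hd); apply.
  exists (fun g => zpow h (e g)); split; last split.
  - by move=> a b; rewrite eM zpowD.
  - by move=> a; apply: subgroup_zpow.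
  - move=> y /Hdec [j [v [/D1 -> ->]]].
    by rewrite gmul1 (additive_zpow G e eM) e1 Z.mul_1_r.
Qed.
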